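(* Let $p$ be a prime, $k \geq 2$, $n \geq 1$, $P(t) \in \mathbb{Z}_p[t]$ non-constant monic, and $R := (\mathbb{Z}/p^k\mathbb{Z})[t]/(P(t))$ with $\bar t$ the image of $t$. Let $\mathfrak r$ be a finite $\mathbb{F}_p[t]/(\bar P(t))$-module, $r := \dim_{\mathbb{F}_p}\mathfrak r$, and $A_n \in \mathrm{M}_n(\mathbb{F}_p)$ with $\mathrm{cok}(\bar P(A_n)) \simeq_{\mathbb{F}_p[t]} \mathfrak r$ and of the form \[A_n = \begin{bmatrix} J & \ast \\ 0 & J'\end{bmatrix},\] where $J \in \mathrm{M}_{n-r}(\mathbb{F}_p)$ has no eigenvalue in $\overline{\mathbb{F}_p}$ that is a root of $\bar P(t)$ and $J' \in \mathrm{M}_r(\mathbb{F}_p)$ has all eigenvalues in $\overline{\mathbb{F}_p}$ roots of $\bar P(t)$. Suppose $\mathrm{M}_n(\mathbb{Z}/p^k\mathbb{Z})_{A_n}$ is given a probability measure under which a random $X$ has independent entries and the entries of the bottom-right $r\times r$ submatrix of $X$ are uniformly distributed (among the allowed values). Then for every finite $R$-module $H$, \[\underset{X \in \mathrm{M}_n(\mathbb{Z}/p^k\mathbb{Z})_{A_n}}{\mathbb{E}}\big(|\mathrm{Sur}_R(\mathrm{cok}_R(X - \bar t I_n), H)|\big) = M_H.\]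
   Context: $\mathrm{M}_n(\mathbb{Z}/p^k\mathbb{Z})_{A_n} := \{X \in \mathrm{M}_n(\mathbb{Z}/p^k\mathbb{Z}) : X \equiv A_n \pmod p\}$. $\mathrm{cok}_R(Z) := R^n/ZR^n$ for $Z \in \mathrm{M}_n(R)$; $\mathrm{Sur}_R(S,T)$ is the set of surjective $R$-linear maps. For $X \in \mathrm{M}_n(\mathbb{Z}/p^k\mathbb{Z})$, $\mathrm{cok}(P(X)) = (\mathbb{Z}/p^k\mathbb{Z})^n/P(X)(\mathbb{Z}/p^k\mathbb{Z})^n$ is an $R$-module with $t$ acting by $X$. $M_H := \mathbb{E}\big(|\mathrm{Sur}_R(\mathrm{cok}(P(X)), H)|\big)$, where $X$ is uniformly distributed on $\mathrm{M}_n(\mathbb{Z}/p^k\mathbb{Z})_{A_n}$ (i.e. the Haar measure; this quantity depends only on $p,k,P,\mathfrak r,H$). *)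

(* Defs.v *)
From HB Require Import structures.
From mathcomp Require Import all_boot all_order all_algebra closed_field.
From mathcomp Require Import boolp reals.

Set Implicit Arguments.
Unset Strict Implicit.
Unset Printing Implicit Defensive.

Import Order.TTheory GRing.Theory Num.Theory.
Local Open Scope ring_scope.
Local Open Scope quotient_scope.

(* Reduction Z/a -> Z/b by representatives; it is the canonical ring morphism
   whenever b divides a, which is the only case in which it is used. *)
Definition zmod_red {a : nat} (b : nat) (x : 'Z_a) : 'Z_b := (x : nat)%:R.

Section ZmodRed.
Variables (p i : nat).

Let dvd_trunc : ((Zp_trunc (p ^ i.+1)).+2 %| (Zp_trunc (p ^ i.+2)).+2)%N.
Proof.
case: p => [|[|q]]; first by rewrite !exp0n.
  by rewrite !exp1n.
by rewrite !Zp_cast ?ltn_exp2l ?(ltn_exp2l 0) // dvdn_exp2l.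
Qed.

Local Notation red := (@zmod_red (p ^ i.+2) (p ^ i.+1)).

Lemma zmod_redD : {morph red : x y / x + y}.
Proof.
move=> x y; apply: val_inj.
by rewrite /zmod_red !Zp_nat /= modn_dvdm // modnDm.
Qed.

Lemma zmod_redM : {morph red : x y / x * y}.
Proof.
move=> x y; apply: val_inj.
by rewrite /zmod_red !Zp_nat /= modn_dvdm // modnMm.
Qed.

Lemma zmod_red1 : red 1 = 1.
Proof. by apply: val_inj; rewrite /zmod_red !Zp_nat /= !modn_small. Qed.

Lemma zmod_red0 : red 0 = 0.
Proof. by []. Qed.

Lemma zmod_redN : {morph red : x / - x}.
Proof.
by move=> x; apply/eqP; rewrite -addr_eq0 -zmod_redD addNr zmod_red0.
Qed.

End ZmodRed.

(* The ring of p-adic integers, as the inverse limit of the rings Z/p^(i+1).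
   The exponent starts at 1 because 'Z_1 is not the zero ring. *)
Record padic (p : nat) : Type := Padic {
  padic_seq :> forall i, 'Z_(p ^ i.+1);
  padic_coherent : forall i, zmod_red (p ^ i.+1) (padic_seq i.+1) = padic_seq i
}.

Section PadicRing.
Variable p : nat.
Implicit Types x y z : padic p.

Lemma padicP x y : (forall i, x i = y i) -> x = y.
Proof.
case: x y => [x hx] [y hy] /= e.
have {}e : x = y by apply: functional_extensionality_dep.
by case: y / e hy => hy; rewrite (Prop_irrelevance hx hy).
Qed.

HB.instance Definition _ := gen_eqMixin (padic p).
HB.instance Definition _ := gen_choiceMixin (padic p).

Definition padic0 : padic p :=
  @Padic p (fun=> 0) (fun i => @zmod_red0 p i).
Definition padic1 : padic p :=
  @Padic p (fun=> 1) (fun i => @zmod_red1 p i).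

Fact padic_add_coherent x y i :
  zmod_red (p ^ i.+1) (x i.+1 + y i.+1) = x i + y i.
Proof. by rewrite zmod_redD !padic_coherent. Qed.
Definition padic_add x y : padic p := Padic (padic_add_coherent x y).

Fact padic_opp_coherent x i : zmod_red (p ^ i.+1) (- x i.+1) = - x i.
Proof. by rewrite zmod_redN padic_coherent. Qed.
Definition padic_opp x : padic p := Padic (padic_opp_coherent x).

Fact padic_mul_coherent x y i :
  zmod_red (p ^ i.+1) (x i.+1 * y i.+1) = x i * y i.
Proof. by rewrite zmod_redM !padic_coherent. Qed.
Definition padic_mul x y : padic p := Padic (padic_mul_coherent x y).

Fact padic_addA : associative padic_add.
Proof. by move=> x y z; apply: padicP => i /=; rewrite addrA. Qed.
Fact padic_addC : commutative padic_add.
Proof. by move=> x y; apply: padicP => i /=; rewrite addrC. Qed.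
Fact padic_add0 : left_id padic0 padic_add.
Proof. by move=> x; apply: padicP => i /=; rewrite add0r. Qed.
Fact padic_addN : left_inverse padic0 padic_opp padic_add.
Proof. by move=> x; apply: padicP => i /=; rewrite addNr. Qed.

HB.instance Definition _ :=
  GRing.isZmodule.Build (padic p) padic_addA padic_addC padic_add0 padic_addN.

Fact padic_mulA : associative padic_mul.
Proof. by move=> x y z; apply: padicP => i /=; rewrite mulrA. Qed.
Fact padic_mulC : commutative padic_mul.
Proof. by move=> x y; apply: padicP => i /=; rewrite mulrC. Qed.
Fact padic_mul1 : left_id padic1 padic_mul.
Proof. by move=> x; apply: padicP => i /=; rewrite mul1r. Qed.
Fact padic_mulD : left_distributive padic_mul +%R.
Proof. by move=> x y z; apply: padicP => i /=; rewrite mulrDl. Qed.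
Fact padic1_neq0 : padic1 != 0.
Proof. by apply/eqP => /(congr1 (fun x : padic p => val (x 0))). Qed.

HB.instance Definition _ := GRing.Zmodule_isComNzRing.Build (padic p)
  padic_mulA padic_mulC padic_mul1 padic_mulD padic1_neq0.

(* x k lives in Z/p^(k+1) and is reduced further to Z/p^k *)
Definition padic_mod (k : nat) (x : padic p) : 'Z_(p ^ k) :=
  zmod_red (p ^ k) (x k).

Definition padic_residue (x : padic p) : 'F_p := zmod_red (pdiv p) (x 0%N).

End PadicRing.

Definition poly_mod (p k : nat) (P : {poly padic p}) : {poly 'Z_(p ^ k)} :=
  map_poly (@padic_mod p k) P.

Definition poly_residue (p : nat) (P : {poly padic p}) : {poly 'F_p} :=
  map_poly (@padic_residue p) P.

HB.instance Definition _ (S : finComNzRingType) (h : {poly S}) :=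
  Finite.on {poly %/ h}.
HB.instance Definition _ (S : finComNzRingType) (h : {poly S}) :=
  GRing.ComNzRing.on {poly %/ h}.

(* M viewed as an S-module through phi : S -> T *)
Definition restrict_scalars (S T : nzRingType) (phi : {rmorphism S -> T})
  (M : lmodType T) : Type := M.

Section RestrictScalars.
Variables (S T : nzRingType) (phi : {rmorphism S -> T}) (M : lmodType T).
Local Notation N := (restrict_scalars phi M).

HB.instance Definition _ := GRing.Zmodule.on N.

Definition restrict_scale (a : S) (x : N) : N := phi a *: (x : M).

Fact restrict_scaleA a b x :
  restrict_scale a (restrict_scale b x) = restrict_scale (a * b) x.
Proof. by rewrite /restrict_scale scalerA rmorphM. Qed.
Fact restrict_scale1 : left_id 1 restrict_scale.
Proof. by move=> x; rewrite /restrict_scale rmorph1 scale1r. Qed.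
Fact restrict_scaleDr : right_distributive restrict_scale +%R.
Proof. by move=> a x y; rewrite /restrict_scale scalerDr. Qed.
Fact restrict_scaleDl x : {morph restrict_scale^~ x : a b / a + b}.
Proof. by move=> a b; rewrite /restrict_scale rmorphD scalerDl. Qed.

HB.instance Definition _ := GRing.Zmodule_isLmodule.Build S N
  restrict_scaleA restrict_scale1 restrict_scaleDr restrict_scaleDl.

End RestrictScalars.

Section Cokernel.
Variables (S : finComNzRingType) (n : nat) (Z : 'M[S]_n).

Definition mx_image : {pred 'cV[S]_n} := fun v => [exists w, v == Z *m w].

Lemma mx_imageP v : reflect (exists w, v = Z *m w) (v \in mx_image).
Proof.
by apply: (iffP existsP) => -[w /eqP e]; exists w => //; apply/eqP.
Qed.

Fact mx_image_zmod_closed : zmod_closed mx_image.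
Proof.
split; first by apply/mx_imageP; exists 0; rewrite mulmx0.
move=> _ _ /mx_imageP[u ->] /mx_imageP[v ->].
by apply/mx_imageP; exists (u - v); rewrite mulmxBr.
Qed.

HB.instance Definition _ :=
  GRing.isZmodClosed.Build 'cV[S]_n mx_image mx_image_zmod_closed.

(* S^n / Z S^n *)
Definition cok : Type := Quotient.quot mx_image.

Definition to_cok (v : 'cV[S]_n) : cok := \pi_(Quotient.quot mx_image) v.
Definition of_cok (x : cok) : 'cV[S]_n := repr x.

Lemma of_cokK : cancel of_cok to_cok.
Proof. exact: reprK. Qed.

Lemma to_cok_eq u v : to_cok u = to_cok v <-> u - v \in mx_image.
Proof.
by rewrite (Quotient.idealrBE mx_image); split=> /eqP.
Qed.

HB.instance Definition _ := GRing.Zmodule.on cok.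
HB.instance Definition _ : isCountable cok := CanIsCountable of_cokK.
HB.instance Definition _ : isFinite cok := CanIsFinite of_cokK.

Lemma to_cokD u v : to_cok (u + v) = to_cok u + to_cok v.
Proof. exact: (raddfD \pi_(Quotient.quot mx_image)). Qed.

Definition cok_scale (a : S) (x : cok) : cok := to_cok (a *: of_cok x).

Lemma cok_scaleE a v : cok_scale a (to_cok v) = to_cok (a *: v).
Proof.
apply/to_cok_eq; rewrite -scalerBr.
have /to_cok_eq/mx_imageP[w ->] := of_cokK (to_cok v).
by apply/mx_imageP; exists (a *: w); rewrite scalemxAr.
Qed.

Fact cok_scaleA a b x : cok_scale a (cok_scale b x) = cok_scale (a * b) x.
Proof. by rewrite -[x]of_cokK !cok_scaleE scalerA. Qed.
Fact cok_scale1 : left_id 1 cok_scale.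
Proof. by move=> x; rewrite -[x]of_cokK cok_scaleE scale1r. Qed.
Fact cok_scaleDr : right_distributive cok_scale +%R.
Proof.
move=> a x y; rewrite -[x]of_cokK -[y]of_cokK -to_cokD !cok_scaleE.
by rewrite scalerDr to_cokD.
Qed.
Fact cok_scaleDl x : {morph cok_scale^~ x : a b / a + b}.
Proof.
by move=> a b; rewrite -[x]of_cokK !cok_scaleE scalerDl to_cokD.
Qed.

HB.instance Definition _ := GRing.Zmodule_isLmodule.Build S cok
  cok_scaleA cok_scale1 cok_scaleDr cok_scaleDl.

End Cokernel.

(* P(X); horner_mx is only available for matrices of size n.+1 *)
Definition mx_eval (S : comNzRingType) n (P : {poly S}) (X : 'M[S]_n) : 'M[S]_n :=
  \sum_(i < size P) P`_i *: X ^+ i.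

Section MxEval.
Variable S : comNzRingType.
Implicit Type P Q : {poly S}.

Lemma mx_eval_horner n P (X : 'M[S]_n.+1) : mx_eval P X = horner_mx X P.
Proof.
rewrite /mx_eval /horner_mx /horner_morph.
rewrite (horner_coef_wide _ (size_poly _ _)).
by apply: eq_bigr => i _; rewrite coef_map /= -mul_scalar_mx.
Qed.

Variables (n : nat) (X : 'M[S]_n).

Lemma mx_evalD P Q : mx_eval (P + Q) X = mx_eval P X + mx_eval Q X.
Proof.
case: n X => [|n'] Y; first by apply/matrixP => -[].
by rewrite !mx_eval_horner rmorphD.
Qed.

Lemma mx_evalM P Q : mx_eval (P * Q) X = mx_eval P X *m mx_eval Q X.
Proof.
case: n X => [|n'] Y; first by apply/matrixP => -[].
by rewrite !mx_eval_horner rmorphM.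
Qed.

Lemma mx_eval1 : mx_eval 1 X = 1%:M.
Proof.
case: n X => [|n'] Y; first by apply/matrixP => -[].
by rewrite mx_eval_horner rmorph1.
Qed.

End MxEval.

Section CokPoly.
Variables (S : finComNzRingType) (P : {poly S}) (n : nat) (X : 'M[S]_n).

(* cok(P(X)), with the S[t]/(P)-module structure in which t acts by X.
   {poly %/ P} is S[t]/(mk_monic P), and mk_monic P is P whenever P is monic
   and non-constant. *)
Definition cok_poly : Type := cok (mx_eval (mk_monic P) X).

HB.instance Definition _ := GRing.Zmodule.on cok_poly.
HB.instance Definition _ := Finite.on cok_poly.

Local Notation to := (to_cok (mx_eval (mk_monic P) X)).

Definition cok_poly_scale (f : {poly %/ P}) (x : cok_poly) : cok_poly :=
  to (mx_eval f X *m of_cok x).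

Lemma cok_poly_scaleE (f : {poly %/ P}) v :
  cok_poly_scale f (to v) = to (mx_eval f X *m v).
Proof.
apply/to_cok_eq; rewrite -mulmxBr.
have /to_cok_eq/mx_imageP[w ->] := of_cokK (to v).
apply/mx_imageP; exists (mx_eval f X *m w).
by rewrite !mulmxA -!mx_evalM mulrC.
Qed.

Fact cok_poly_scaleA f g x :
  cok_poly_scale f (cok_poly_scale g x) = cok_poly_scale (f * g) x.
Proof.
rewrite -[x]of_cokK !cok_poly_scaleE; apply/to_cok_eq.
rewrite mulmxA -mx_evalM -mulmxBl; apply/mx_imageP.
rewrite {1}(Pdiv.RingMonic.rdivp_eq (monic_mk_monic P) (val f * val g)).
rewrite mx_evalD poly_of_qpolyM addrK mulrC mx_evalM -mulmxA.
by eexists.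
Qed.
Fact cok_poly_scale1 : left_id 1 cok_poly_scale.
Proof.
by move=> x; rewrite -[x]of_cokK cok_poly_scaleE mx_eval1 mul1mx.
Qed.
Fact cok_poly_scaleDr : right_distributive cok_poly_scale +%R.
Proof.
move=> f x y; rewrite -[x]of_cokK -[y]of_cokK.
by rewrite -to_cokD !cok_poly_scaleE mulmxDr to_cokD.
Qed.
Fact cok_poly_scaleDl x : {morph cok_poly_scale^~ x : f g / f + g}.
Proof.
move=> f g; rewrite -[x]of_cokK !cok_poly_scaleE.
by rewrite poly_of_qpolyD mx_evalD mulmxDl to_cokD.
Qed.

HB.instance Definition _ := GRing.Zmodule_isLmodule.Build {poly %/ P} cok_poly
  cok_poly_scaleA cok_poly_scale1 cok_poly_scaleDr cok_poly_scaleDl.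

End CokPoly.

Definition lmod_iso (S : nzRingType) (M N : lmodType S) : Prop :=
  exists f : {linear M -> N}, bijective f.

Definition Sur (S : nzRingType) (M N : finLmodType S) : {set {ffun M -> N}} :=
  [set f : {ffun M -> N} | `[< linear f /\ forall y, exists x, f x = y >]].

(* cok_R(X - t I_n) for R = S[t]/(P), t being the image of the variable in R *)
Definition cok_sub_t (S : finComNzRingType) (P : {poly S}) n (X : 'M[S]_n) :
  finLmodType {poly %/ P} := @cok {poly %/ P} n (map_mx (qpolyC P) X - ('qX)%:M).

Definition Fp_closure (p : nat) : countClosedFieldType :=
  projT1 (countable_algebraic_closure 'F_p).

Definition Fp_embed (p : nat) : {rmorphism 'F_p -> Fp_closure p} :=
  sval (projT2 (countable_algebraic_closure 'F_p)).

Definition eigenvalue_bar (p n : nat) (J : 'M['F_p]_n) (a : Fp_closure p) : bool :=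
  eigenvalue (map_mx (Fp_embed p) J) a.

Definition root_bar (p : nat) (Q : {poly 'F_p}) (a : Fp_closure p) : bool :=
  root (map_poly (Fp_embed p) Q) a.

(* M_n(Z/p^k)_A *)
Definition mx_fiber (p k n : nat) (A : 'M['F_p]_n) : {set 'M['Z_(p ^ k)]_n} :=
  [set X | map_mx (zmod_red (pdiv p)) X == A].

(* A probability measure on a finite set D is given by its mass function, whose
   values outside D are irrelevant. *)
Section Probability.
Variables (R : realType) (T : finType) (D : {set T}).

Definition is_prob (mu : T -> R) : Prop :=
  (forall x, x \in D -> 0 <= mu x) /\ \sum_(x in D) mu x = 1.

Definition Pr (mu : T -> R) (E : pred T) : R := \sum_(x in D | E x) mu x.

Definition Ex (mu : T -> R) (f : T -> R) : R := \sum_(x in D) mu x * f x.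

Definition unif : T -> R := fun=> (#|D|%:R)^-1.

End Probability.

Section MatrixMeasure.
Variables (R : realType) (p k n : nat) (A : 'M['F_p]_n).
Variable mu : 'M['Z_(p ^ k)]_n -> R.
Local Notation D := (mx_fiber k A).

Definition independent_entries : Prop :=
  forall B : 'I_n -> 'I_n -> {set 'Z_(p ^ k)},
    Pr D mu (fun X => [forall i, forall j, X i j \in B i j]) =
    \prod_i \prod_j Pr D mu (fun X => X i j \in B i j).

Definition uniform_entry (i j : 'I_n) : Prop :=
  forall a : 'Z_(p ^ k), zmod_red (pdiv p) a = A i j ->
    Pr D mu (fun X => X i j == a) =
    (#|[set b : 'Z_(p ^ k) | zmod_red (pdiv p) b == A i j]|%:R)^-1.

End MatrixMeasure.

(* M_H *)
Definition sur_moment (R : realType) (p k n : nat) (P : {poly 'Z_(p ^ k)})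
    (A : 'M['F_p]_n) (H : finLmodType {poly %/ P}) : R :=
  Ex (mx_fiber k A) (unif R (mx_fiber k A))
     (fun X => #|Sur (cok_poly P X) H|%:R).

(* Main.v *)
(* Both moments count the same tuples: an R-surjection from cok(P(X)), or from
   cok_R(X - t), onto H is a tuple h in H^n that generates H and satisfies
   h X = t h.  Write X = [X1 X2; X3 X4] and h = (h1, h2).  As P(J) is invertible
   and P(t) = 0, right multiplication by X1 - t is bijective on H^(n-r), so the
   first block of equations determines h1 from h2, with h1 in pH because p | X3.
   By Nakayama h2 then generates H on its own, hence the contribution h1 X2 to
   the second block can be absorbed by translating X4 by a multiple of p.
   Summing over the admissible X4 therefore gives a number independent of X1, X2
   and X3, and independence of the entries makes the law of X4 uniform
   conditionally on the other blocks. *)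
Require Import Defs.
From HB Require Import structures.
From mathcomp Require Import all_boot all_order all_algebra closed_field.
From mathcomp Require Import boolp reals.

Set Implicit Arguments.
Unset Strict Implicit.
Unset Printing Implicit Defensive.

Import Order.TTheory GRing.Theory Num.Theory.
Local Open Scope ring_scope.

(** * Tuples of module elements multiplied by scalar matrices *)

Lemma mxDE (V : nmodType) m n (A B : 'M[V]_(m, n)) i j :
  (A + B) i j = A i j + B i j.
Proof. by rewrite mxE. Qed.

Section ModuleMatrix.
Variables (T : comNzRingType) (H : lmodType T).

(** The product [h Z] where the entries of [h] lie in a module; commutativity of [T] makes it a
    right action of matrices although scalars act on the left. *)
Definition vmul a n q (h : 'M[H]_(a, n)) (Z : 'M[T]_(n, q)) : 'M[H]_(a, q) :=
  \matrix_(i, j) \sum_l Z l j *: h i l.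

Lemma vmul0 a n q (h : 'M[H]_(a, n)) : vmul h (0 : 'M_(n, q)) = 0.
Proof.
by apply/matrixP => i j; rewrite !mxE big1 // => l _; rewrite mxE scale0r.
Qed.

Lemma vmul0l a n q (Z : 'M[T]_(n, q)) : vmul (0 : 'M_(a, n)) Z = 0.
Proof.
by apply/matrixP => i j; rewrite !mxE big1 // => l _; rewrite mxE scaler0.
Qed.

Lemma vmulDl a n q (h g : 'M[H]_(a, n)) (Z : 'M[T]_(n, q)) :
  vmul (h + g) Z = vmul h Z + vmul g Z.
Proof.
apply/matrixP => i j; rewrite !mxE -big_split /=.
by apply: eq_bigr => l _; rewrite !mxE scalerDr.
Qed.

Lemma vmulDr a n q (h : 'M[H]_(a, n)) (Z W : 'M[T]_(n, q)) :
  vmul h (Z + W) = vmul h Z + vmul h W.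
Proof.
apply/matrixP => i j; rewrite !mxE -big_split /=.
by apply: eq_bigr => l _; rewrite !mxE scalerDl.
Qed.

Lemma vmulNl a n q (h : 'M[H]_(a, n)) (Z : 'M[T]_(n, q)) :
  vmul (- h) Z = - vmul h Z.
Proof.
apply/matrixP => i j; rewrite !mxE -sumrN.
by apply: eq_bigr => l _; rewrite !mxE scalerN.
Qed.

Lemma vmulNr a n q (h : 'M[H]_(a, n)) (Z : 'M[T]_(n, q)) :
  vmul h (- Z) = - vmul h Z.
Proof.
apply/matrixP => i j; rewrite !mxE -sumrN.
by apply: eq_bigr => l _; rewrite !mxE scaleNr.
Qed.

Lemma vmulBl a n q (h g : 'M[H]_(a, n)) (Z : 'M[T]_(n, q)) :
  vmul (h - g) Z = vmul h Z - vmul g Z.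
Proof. by rewrite vmulDl vmulNl. Qed.

Lemma vmulBr a n q (h : 'M[H]_(a, n)) (Z W : 'M[T]_(n, q)) :
  vmul h (Z - W) = vmul h Z - vmul h W.
Proof. by rewrite vmulDr vmulNr. Qed.

Lemma vmulA a n q s (h : 'M[H]_(a, n)) (Z : 'M[T]_(n, q)) (W : 'M[T]_(q, s)) :
  vmul (vmul h Z) W = vmul h (Z *m W).
Proof.
apply/matrixP => i j; rewrite !mxE.
under eq_bigr => l _ do rewrite mxE scaler_sumr.
rewrite exchange_big /=; apply: eq_bigr => l _.
rewrite mxE scaler_suml; apply: eq_bigr => u _.
by rewrite scalerA mulrC.
Qed.

Lemma vmul_scalar a n (h : 'M[H]_(a, n)) (c : T) i j :
  vmul h c%:M i j = c *: h i j.
Proof.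
rewrite !mxE (bigD1 j) //= mxE eqxx big1 ?addr0 // => l /negPf lj.
by rewrite mxE lj scale0r.
Qed.

Lemma vmul1 a n (h : 'M[H]_(a, n)) : vmul h 1%:M = h.
Proof. by apply/matrixP => i j; rewrite vmul_scalar scale1r. Qed.

Lemma vmul_scalarC a n q (h : 'M[H]_(a, n)) (c : T) (Z : 'M[T]_(n, q)) :
  vmul (vmul h Z) c%:M = vmul (vmul h c%:M) Z.
Proof. by rewrite !vmulA scalar_mxC. Qed.

Lemma vmul_col a n q (h : 'M[H]_(a, n)) (Z : 'M[T]_(n, q)) i j :
  vmul h Z i j = vmul h (col j Z) i 0.
Proof. by rewrite !mxE; apply: eq_bigr => l _; rewrite mxE. Qed.

Lemma vmul_row_col a m n q (h : 'M[H]_(a, m)) (g : 'M[H]_(a, n))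
    (Z : 'M[T]_(m, q)) (W : 'M[T]_(n, q)) :
  vmul (row_mx h g) (col_mx Z W) = vmul h Z + vmul g W.
Proof.
apply/matrixP => i j; rewrite !mxE big_split_ord /=; congr (_ + _);
  by apply: eq_bigr => l _; rewrite ?col_mxEu ?col_mxEd ?row_mxEl ?row_mxEr.
Qed.

Lemma vmul_mx_row a n q s (h : 'M[H]_(a, n)) (Z : 'M[T]_(n, q))
    (W : 'M[T]_(n, s)) :
  vmul h (row_mx Z W) = row_mx (vmul h Z) (vmul h W).
Proof.
apply/matrixP => i j; rewrite !mxE; under eq_bigr => l _ do rewrite mxE.
by case: (split j) => u; rewrite mxE.
Qed.

Lemma vmul_block a m n q s (h : 'M[H]_(a, m)) (g : 'M[H]_(a, n))
    (Z1 : 'M[T]_(m, q)) (Z2 : 'M[T]_(m, s))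
    (Z3 : 'M[T]_(n, q)) (Z4 : 'M[T]_(n, s)) :
  vmul (row_mx h g) (block_mx Z1 Z2 Z3 Z4)
    = row_mx (vmul h Z1 + vmul g Z3) (vmul h Z2 + vmul g Z4).
Proof. by rewrite block_mxEv vmul_row_col !vmul_mx_row add_row_mx. Qed.

End ModuleMatrix.

Lemma map_vmul (T : comNzRingType) (H N : lmodType T) (f : {linear H -> N})
    a n q (h : 'M[H]_(a, n)) (Z : 'M[T]_(n, q)) :
  map_mx f (vmul h Z) = vmul (map_mx f h) Z.
Proof.
apply/matrixP => i j; rewrite !mxE linear_sum.
by apply: eq_bigr => l _; rewrite linearZ mxE.
Qed.

(** * Generation over a base ring and Nakayama's lemma *)

Section Generation.
Variables (S T : comNzRingType) (phi : {rmorphism S -> T}) (H : lmodType T).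

(** Coefficients come from [S] rather than [T]: a relation between entries can then be absorbed into
    a matrix over [S]. *)
Definition generates n (h : 'rV[H]_n) : Prop :=
  forall y : H, exists v : 'cV[S]_n, y = vmul h (map_mx phi v) 0 0.

Lemma generates_mx n (h : 'rV[H]_n) q (g : 'rV[H]_q) : generates h ->
  exists Z : 'M[S]_(n, q), g = vmul h (map_mx phi Z).
Proof.
move=> gen_h; have [v vE] := choice (fun j => gen_h (g 0 j)).
exists (\matrix_(i, j) v j i 0); apply/rowP => j.
rewrite vE !mxE; apply: eq_bigr => l _; by rewrite !mxE.
Qed.

(* Nakayama's lemma for the nilpotent element a. *)
Lemma generates_row_nilp m n (g : 'rV[H]_m) (h : 'rV[H]_n) (a : S) k :
    a ^+ k = 0 ->
  generates (row_mx (vmul g (phi a)%:M) h) <-> generates h.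
Proof.
move=> ak0; split=> gen y; last first.
  have [v ->] := gen y; exists (col_mx 0 v).
  by rewrite map_col_mx vmul_row_col map_mx0 vmul0 add0r.
(* Every [y] lies in the [S]-span of [h] plus [a ^+ k] times H, by induction on the exponent;
   nilpotency then removes the second term. *)
suff [v [z]] : exists (v : 'cV[S]_n) (z : H),
    y = vmul h (map_mx phi v) 0 0 + phi (a ^+ k) *: z.
  by rewrite ak0 rmorph0 scale0r addr0 => ->; exists v.
elim: k {ak0} => [|k [v [z ->]]].
  exists 0, y; by rewrite map_mx0 vmul0 mxE add0r rmorph1 scale1r.
have [w ->] := gen z.
rewrite -[w]vsubmxK map_col_mx vmul_row_col -vmul_scalarC mxDE vmul_scalar.
(* Writing [z] as [a] times a combination of [g] plus a combination of [h], the second joins the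
   span and the first raises the exponent by one. *)
exists (v + a ^+ k *: dsubmx w), (vmul g (map_mx phi (usubmx w)) 0 0).
rewrite map_mxD vmulDr !mxDE scalerDr scalerA -rmorphM /= -exprSr -addrA.
congr (_ + _); rewrite addrC map_mxZ -mul_scalar_mx -vmulA.
by rewrite -vmul_scalarC vmul_scalar.
Qed.

End Generation.

(** * Polynomials in a matrix acting on solutions of [h X = t h] *)

Section MxEvalExtra.
Variables (S : comNzRingType) (n : nat) (X : 'M[S]_n).

Lemma mx_evalX : mx_eval 'X X = X.
Proof.
case: n X => [|n'] Y; first by apply/matrixP => -[].
by rewrite mx_eval_horner horner_mx_X.
Qed.

Lemma mx_evalC c : mx_eval c%:P X = c%:M.
Proof.
case: n X => [|n'] Y; first by apply/matrixP => -[].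
by rewrite mx_eval_horner horner_mx_C.
Qed.

Lemma map_mx_eval (S' : comNzRingType) (f : {rmorphism S -> S'})
    (Q : {poly S}) :
  map_mx f (mx_eval Q X) = mx_eval (map_poly f Q) (map_mx f X).
Proof.
case: n X => [|n'] Y; first by apply/matrixP => -[].
by rewrite !mx_eval_horner map_horner_mx.
Qed.

End MxEvalExtra.

Section QuotientModule.
Variables (S : finComNzRingType) (P : {poly S}).
Local Notation T := {poly %/ P}.
Local Notation "A ^q" := (map_mx (qpolyC P) A) (at level 2, format "A ^q").

Lemma in_qpoly_mk_monic : in_qpoly P (mk_monic P) = 0.
Proof. by apply: val_inj; rewrite /= Pdiv.RingMonic.rmodpp ?monic_mk_monic. Qed.

Lemma in_qpoly_val (g : T) : in_qpoly P g = g.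
Proof. exact: val_inj (in_qpoly_small (size_mk_monic g)). Qed.

Lemma in_qpolyC c : in_qpoly P c%:P = qpolyC P c.
Proof. by rewrite -[RHS]in_qpoly_val qpolyCE. Qed.

(** Right multiplication by X is the action of t on [h], hence g(X) acts as g(t); Horner's scheme
    gives the induction. *)
Lemma vmul_mx_eval (H : lmodType T) a n (h : 'M[H]_(a, n)) (X : 'M[S]_n)
    (g : {poly S}) : vmul h (X^q - ('qX)%:M) = 0 ->
  vmul h (mx_eval g X)^q = vmul h (in_qpoly P g)%:M.
Proof.
move/eqP; rewrite vmulBr subr_eq0 => /eqP hX.
elim/poly_ind: g => [|g c IH].
  by rewrite in_qpoly0 -polyC0 mx_evalC !raddf0.
rewrite mx_evalD mx_evalM mx_evalX mx_evalC in_qpolyD in_qpolyM in_qpolyC.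
rewrite map_mxD map_mxM map_scalar_mx raddfD /= !vmulDr; congr (_ + _).
rewrite -vmulA IH -vmul_scalarC hX vmulA -scalar_mxM.
by rewrite mulrC.
Qed.

(** A coefficient g(t) on the entry [h_j] is traded for column j of g(X), whose entries are in
    [S]. *)
Lemma generates_scalars (H : lmodType T) n (h : 'rV[H]_n) (X : 'M[S]_n) :
    vmul h (X^q - ('qX)%:M) = 0 ->
    (forall y, exists v : 'cV[T]_n, y = vmul h v 0 0) ->
  generates (qpolyC P) h.
Proof.
move=> hX gen y; have [v ->] := gen y.
exists (\sum_j mx_eval (v j 0) X *m delta_mx j 0).
rewrite raddf_sum /=.
have -> (F : 'I_n -> 'cV[T]_n) : vmul h (\sum_j F j) = \sum_j vmul h (F j).
  apply: (big_morph (vmul h)) => [Z W|]; [exact: vmulDr | exact: vmul0].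
rewrite summxE mxE; apply: eq_bigr => j _.
rewrite map_mxM -vmulA vmul_mx_eval // in_qpoly_val mxE (bigD1 j) //=.
rewrite vmul_scalar !mxE !eqxx rmorph1 scale1r big1 ?addr0 // => l /negPf lj.
by rewrite !mxE lj rmorph0 scale0r.
Qed.

End QuotientModule.

(** * Surjections counted as generating tuples *)

Section CountSurjections.
Variables (S : comNzRingType) (T : finComNzRingType) (phi : {rmorphism S -> T}).

(** A linear map is determined by the image of the generating row [e]. Such images satisfy the
    relations [Z]; conversely [extend], the universal property of M, realises every solution, and
    surjectivity means that the image generates H. *)
Lemma card_Sur (M H : finLmodType T) n q (e : 'rV[M]_n) (Z : 'M[T]_(n, q)) :
    generates phi e -> vmul e Z = 0 ->
    (forall h : 'rV[H]_n, vmul h Z = 0 ->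
       exists f : {linear M -> H}, map_mx f e = h) ->
  #|Sur M H| =
    #|[set h : 'rV[H]_n | (vmul h Z == 0) && `[< generates phi h >]]|.
Proof.
move=> gen_e eZ extend; pose F (f : {ffun M -> H}) := map_mx f e.
have fE (f : M -> H) : linear f -> exists g : {linear M -> H}, f = g.
  move=> lin_f.
  by exists (HB.pack_for {linear M -> H} f
    (GRing.isLinear.Build _ _ _ _ f lin_f)).
rewrite -(card_in_imset (f := F) (D := mem (Sur M H))); last first.
  move=> f1 f2; rewrite !inE => /asboolP[/fE[g1 g1E] _] /asboolP[/fE[g2 g2E] _].
  rewrite /F g1E g2E => eq12; apply/ffunP => x; rewrite g1E g2E.
  have [v ->] := gen_e x.
  move: (congr1 (fun h => vmul h (map_mx phi v) 0 0) eq12) => /=.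
  by rewrite -!map_vmul ![map_mx _ _ _ _]mxE.
apply: eq_card => h; rewrite inE.
apply/imsetP/andP => [[f]|[/eqP hZ /asboolP gen_h]].
  rewrite inE => /asboolP[/fE[g gE] surj_f] ->; split.
    by rewrite /F gE -map_vmul eZ map_mx0.
  apply/asboolP => y; have [x <-] := surj_f y.
  have [v ->] := gen_e x; exists v.
  by rewrite /F gE -map_vmul [in RHS]mxE.
have [f fe] := extend h hZ; exists (finfun f); last first.
  by rewrite -fe; apply/rowP => j; rewrite !mxE ffunE.
rewrite inE; apply/asboolP; split=> [c x y|y].
  by rewrite !ffunE linearP.
have [v ->] := gen_h y; exists (vmul e (map_mx phi v) 0 0).
by rewrite ffunE -fe -map_vmul [in RHS]mxE.
Qed.

End CountSurjections.

Section CokernelGenerators.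
Variables (S : finComNzRingType) (n : nat) (Z : 'M[S]_n).

Lemma to_cok0 : to_cok Z 0 = 0.
Proof. by apply: (addIr (to_cok Z 0)); rewrite -to_cokD !add0r. Qed.

Lemma to_cok_delta v :
  to_cok Z v = \sum_i to_cok Z (v i 0 *: delta_mx i 0).
Proof.
rewrite [in LHS](matrix_sum_delta v) (big_morph _ (to_cokD Z) to_cok0).
by apply: eq_bigr => i _; rewrite big_ord1.
Qed.

End CokernelGenerators.

Section CokernelSurjections.
Variables (S : finComNzRingType) (P : {poly S}) (n : nat) (X : 'M[S]_n).
Local Notation T := {poly %/ P}.
Local Notation "A ^q" := (map_mx (qpolyC P) A) (at level 2, format "A ^q").
Variable H : finLmodType T.

(** The images of the standard basis under surjections onto H, for either of the two cokernels. *)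
Definition gen_solutions : {set 'rV[H]_n} :=
  [set h | (vmul h (X^q - ('qX)%:M) == 0) && `[< generates (qpolyC P) h >]].

Lemma card_Sur_cok_sub_t : #|Sur (cok_sub_t P X) H| = #|gen_solutions|.
Proof.
set Z := X^q - ('qX)%:M.
pose e : 'rV[cok_sub_t P X]_n := \row_j to_cok Z (delta_mx j 0).
have eE v : vmul e v 0 0 = to_cok Z v.
  rewrite mxE to_cok_delta.
  by apply: eq_bigr => l _; rewrite mxE -(cok_scaleE Z).
have eZ : vmul e Z = 0.
  apply/rowP => j; rewrite vmul_col eE mxE -(to_cok0 Z); apply/to_cok_eq.
  rewrite subr0; apply/mx_imageP; exists (delta_mx j 0).
  by rewrite colE.
apply: (card_Sur (e := e) (Z := Z)) => // [|h hZ].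
  apply: generates_scalars eZ _ => y; exists (of_cok y).
  by rewrite eE of_cokK.
pose f (x : cok_sub_t P X) := vmul h (of_cok x) 0 0.
(* The chosen representative of the class of [v] differs from [v] by some [Z w], which [h] kills. *)
have fE v : f (to_cok Z v) = vmul h v 0 0.
  have /to_cok_eq/mx_imageP[w /(canRL (subrK _))] := of_cokK (to_cok Z v).
  by rewrite /f => ->; rewrite vmulDr -vmulA hZ vmul0l add0r.
have lin_f : linear f.
  move=> c x y; rewrite -[x]of_cokK -[y]of_cokK.
  rewrite [c *: _](cok_scaleE Z) -to_cokD !fE vmulDr mxDE.
  congr (_ + _); rewrite !mxE scaler_sumr.
  by apply: eq_bigr => l _; rewrite mxE scalerA.
exists (HB.pack_for {linear cok_sub_t P X -> H} f
  (GRing.isLinear.Build _ _ _ _ f lin_f)).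
apply/rowP => j; rewrite [LHS]mxE [e _ _]mxE /= fE.
rewrite mxE (bigD1 j) //= mxE !eqxx scale1r big1 ?addr0 // => l /negPf lj.
by rewrite mxE lj scale0r.
Qed.

(** Replacing g by its remainder modulo P changes g(X) v only by an element of the image of P(X). *)
Lemma cok_poly_scale_in_qpoly (g : {poly S}) v :
  in_qpoly P g *: (to_cok _ v : cok_poly P X)
    = to_cok _ (mx_eval g X *m v) :> cok_poly P X.
Proof.
rewrite [LHS]cok_poly_scaleE; apply/to_cok_eq/mx_imageP.
rewrite [in mx_eval g X](Pdiv.RingMonic.rdivp_eq (monic_mk_monic P) g).
rewrite mx_evalD mulmxDl opprD addrCA subrr addr0 mulrC mx_evalM.
rewrite -mulmxA -mulmxN.
by eexists.
Qed.

(** The relations [h X = t h] suffice to define a map on the cokernel of P(X), because they force h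
    P(X) = P(t) h = 0. *)
Lemma card_Sur_cok_poly : #|Sur (cok_poly P X) H| = #|gen_solutions|.
Proof.
set Y := mx_eval (mk_monic P) X.
pose e : 'rV[cok_poly P X]_n := \row_j to_cok Y (delta_mx j 0).
have eE (v : 'cV[S]_n) : vmul e v^q 0 0 = to_cok Y v.
  rewrite mxE to_cok_delta; apply: eq_bigr => l _.
  by rewrite !mxE -in_qpolyC cok_poly_scale_in_qpoly mx_evalC mul_scalar_mx.
have eX : vmul e (X^q - ('qX)%:M) = 0.
  apply/eqP; rewrite vmulBr subr_eq0; apply/eqP/rowP => j.
  rewrite vmul_col -map_col eE vmul_scalar [e _ _]mxE /qpolyX.
  by rewrite cok_poly_scale_in_qpoly mx_evalX colE.
apply: (card_Sur (e := e) (Z := X^q - ('qX)%:M)) => // [y|h hX].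
  by exists (of_cok y); rewrite eE of_cokK.
pose f (x : cok_poly P X) := vmul h (of_cok x)^q 0 0.
have fE v : f (to_cok Y v) = vmul h v^q 0 0.
  have /to_cok_eq/mx_imageP[w /(canRL (subrK _))] := of_cokK (to_cok Y v).
  rewrite /f => ->; rewrite map_mxD vmulDr map_mxM -vmulA vmul_mx_eval //.
  by rewrite in_qpoly_mk_monic raddf0 vmul0 vmul0l add0r.
have lin_f : linear f.
  move=> c x y; rewrite -[x]of_cokK -[y]of_cokK.
  rewrite [c *: _]cok_poly_scaleE -to_cokD !fE map_mxD vmulDr mxDE.
  congr (_ + _); rewrite map_mxM -vmulA vmul_mx_eval // in_qpoly_val.
  by rewrite -vmul_scalarC vmul_scalar.
exists (HB.pack_for {linear cok_poly P X -> H} f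
  (GRing.isLinear.Build _ _ _ _ f lin_f)).
apply/rowP => j; rewrite [LHS]mxE [e _ _]mxE /= fE.
rewrite mxE (bigD1 j) //= !mxE !eqxx rmorph1 scale1r big1 ?addr0 //.
by move=> l /negPf lj; rewrite !mxE lj rmorph0 scale0r.
Qed.

End CokernelSurjections.

(** * Double counting and elimination of the first block *)

Lemma sum_card_exchange (I J : finType) (D : {set I}) (Q : pred J)
    (E : I -> J -> bool) :
  (\sum_(x in D) #|[set y | E x y && Q y]| =
   \sum_(y | Q y) #|[set x in D | E x y]|)%N.
Proof.
under eq_bigr => x _ do rewrite cardsE -sum1_card.
under [RHS]eq_bigr => y _ do rewrite cardsE -sum1_card.
rewrite [RHS](exchange_big_dep (mem D)) /=; last first.
  by move=> y x _ /andP[].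
apply: eq_bigr => x Dx; apply: eq_bigl => y.
by rewrite ![_ \in _]/(_ && _) Dx andbC.
Qed.

Section BlockReduction.
Variables (S : finComNzRingType) (P : {poly S}) (H : finLmodType {poly %/ P}).
Variables (a : S) (k : nat) (m r : nat).
Hypothesis a_nilp : a ^+ k = 0.
Local Notation "A ^q" := (map_mx (qpolyC P) A) (at level 2, format "A ^q").

(** If h (X - t) = 0 then h P(X) = P(t) h = 0, so h = 0 as P(X) is invertible; injectivity suffices
    on a finite set. *)
Lemma vmul_sub_t_bij n (X U : 'M[S]_n) :
    mx_eval (mk_monic P) X *m U = 1%:M ->
  bijective (fun h : 'rV[H]_n => vmul h (X^q - ('qX)%:M)).
Proof.
move=> PXU; apply: injF_bij => h g /eqP; rewrite -subr_eq0 -vmulBl => /eqP hg.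
apply/eqP; rewrite -subr_eq0 -[h - g]vmul1 -(map_scalar_mx (qpolyC P)).
rewrite -PXU map_mxM -vmulA vmul_mx_eval // in_qpoly_mk_monic raddf0.
by rewrite vmul0 vmul0l.
Qed.

(* For a generating solution (h1, h2), the first block of equations determines
   h1 = a g from h2, since X1 - t acts invertibly; as h2 still generates H by
   Nakayama, g X2 = h2 Z for some scalar matrix Z, and the second block becomes
   h2 (X4 + a Z - t) = 0. *)
Lemma sum_gen_solutions_block (X1 U : 'M[S]_m) (X2 : 'M[S]_(m, r))
    (Y3 : 'M[S]_(r, m)) (D : {set 'M[S]_r}) :
    mx_eval (mk_monic P) X1 *m U = 1%:M ->
    (forall X Z, X \in D -> X + a *: Z \in D) ->
  (\sum_(X4 in D) #|gen_solutions (block_mx X1 X2 (a *: Y3) X4) H| =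
   \sum_(X4 in D) #|gen_solutions X4 H|)%N.
Proof.
move=> PX1U D_add; have [inv psiK invK] := vmul_sub_t_bij PX1U.
(* Dividing the first block equation by [X1 - t] gives h1 = a g(h2), the factor [a] coming from the
   lower-left block. *)
pose g (h : 'rV[H]_r) := inv (- vmul h Y3^q).
pose s h := row_mx (vmul (g h) (qpolyC P a)%:M) h.
pose E (X4 : 'M[S]_r) h := vmul (vmul (g h) (qpolyC P a)%:M) X2^q +
   vmul h (X4^q - ('qX)%:M) == 0.
have s_inj : injective s by move=> h h' /eq_row_mx[].
have nakayama h := generates_row_nilp (qpolyC P) (g h) h a_nilp.
have -> : (\sum_(X4 in D) #|gen_solutions (block_mx X1 X2 (a *: Y3) X4) H| =
    \sum_(X4 in D)
      #|[set h : 'rV[H]_r | E X4 h && `[< generates (qpolyC P) h >]]|)%N.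
  (* The map [s] carries solutions h2 of the reduced equation bijectively to full solutions;
     Nakayama transfers generation both ways. *)
  apply: eq_bigr => X4 _; rewrite -[RHS](card_imset _ s_inj).
  apply: eq_card => h; rewrite inE map_block_mx (scalar_mx_block m r).
  rewrite opp_block_mx add_block_mx !oppr0 !addr0 -[h]hsubmxK vmul_block.
  rewrite map_mxZ -mul_scalar_mx -[vmul _ (_ *m _)]vmulA /=.
  set h1 := lsubmx h; set h2 := rsubmx h.
  have sE :
      (vmul h1 (X1^q - ('qX)%:M) + vmul (vmul h2 (qpolyC P a)%:M) Y3^q == 0)
      = (h1 == vmul (g h2) (qpolyC P a)%:M).
    rewrite -[RHS](inj_eq (can_inj psiK)) /= -(vmul_scalarC (g h2)) invK.
    rewrite vmulNl vmul_scalarC.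
    by rewrite addr_eq0.
  apply/andP/imsetP => [[/eqP]|[h' h'D]].
    rewrite -[0]row_mx0 => /eq_row_mx[/eqP]; rewrite sE => /eqP e1 e2 gen.
    exists h2; last by rewrite /s -e1.
    rewrite inE /E -e1 e2 eqxx; apply/asboolP.
    by apply/(nakayama h2); rewrite -e1; apply/asboolP.
  move=> /eq_row_mx[e1 e2]; move: h'D; rewrite -e2 in e1 *.
  rewrite inE => /andP[/eqP hE /asboolP gen]; move/eqP: (e1).
  rewrite -sE => /eqP ->.
  rewrite e1 hE row_mx0 eqxx; split=> //.
  by apply/asboolP/(nakayama h2).
(* With the sums exchanged, [h] is fixed and the matrices X4 are counted, so the translation by
   [a *: Z] may depend on [h]. *)
rewrite sum_card_exchange.
under [RHS]eq_bigr => X4 _ do rewrite /gen_solutions.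
rewrite [RHS]sum_card_exchange; apply: eq_bigr => h /asboolP gen.
have [Z ZE] := generates_mx (vmul (g h) X2^q) gen.
have addZ_bij : bijective (fun X : 'M[S]_r => X + a *: Z).
  by exists (fun X => X - a *: Z) => X; rewrite ?addrK ?subrK.
rewrite -[RHS](on_card_preimset (f := fun X => X + a *: Z)); last first.
  exact: onW_bij.
apply: eq_card => X; rewrite !inE; congr (_ && _).
  (* Stability of [D] under translation by [- Z] gives the converse inclusion. *)
  apply/idP/idP => [/D_add //|/(D_add _ (- Z))].
  by rewrite scalerN addrK.
rewrite /E -vmul_scalarC ZE map_mxD map_mxZ /= -mul_scalar_mx -scalar_mxC.
by rewrite vmulA -vmulDr addrCA addrA.
Qed.

End BlockReduction.

(** * Reduction from Z/p^k to the residue field *)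

Section Reduction.

Lemma zmod_redK (a b c : nat) (x : 'Z_a) :
    ((Zp_trunc c).+2 %| (Zp_trunc b).+2)%N ->
  zmod_red c (zmod_red b x) = zmod_red c x.
Proof.
by move=> c_b; apply: val_inj; rewrite /zmod_red !Zp_nat /= modn_dvdm.
Qed.

Variables (p k : nat).
Hypotheses (p_prime : prime p) (k_gt0 : (0 < k)%N).
Local Notation red := (@zmod_red (p ^ k) (pdiv p)).

Let pk_gt1 : (1 < p ^ k)%N.
Proof. by rewrite -(exp1n k) ltn_exp2r // prime_gt1. Qed.

Lemma Fp_trunc_dvd : ((Zp_trunc (pdiv p)).+2 %| (Zp_trunc (p ^ k)).+2)%N.
Proof. by rewrite pdiv_id // !Zp_cast // ?prime_gt1 // dvdn_exp. Qed.

Fact zmod_red_zmod_morphism : zmod_morphism red.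
Proof.
have redD : {morph red : x y / x + y}.
  move=> x y; apply: val_inj.
  by rewrite /zmod_red !Zp_nat /= modn_dvdm ?Fp_trunc_dvd // modnDm.
move=> x y; apply: (addIr (red y)).
by rewrite -redD !subrK.
Qed.

Fact zmod_red_monoid_morphism : monoid_morphism red.
Proof.
split=> [|x y]; apply: val_inj; first by rewrite /zmod_red !Zp_nat.
by rewrite /zmod_red !Zp_nat /= modn_dvdm ?Fp_trunc_dvd // modnMm.
Qed.

Definition Fp_red : {rmorphism 'Z_(p ^ k) -> 'F_p} :=
  HB.pack_for {rmorphism 'Z_(p ^ k) -> 'F_p} red
    (GRing.isZmodMorphism.Build _ _ red zmod_red_zmod_morphism)
    (GRing.isMonoidMorphism.Build _ _ red zmod_red_monoid_morphism).

Lemma Fp_red_eq0 x : (Fp_red x == 0) = (p %| x)%N.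
Proof. by rewrite (dvdn_pcharf (pchar_Fp p_prime)). Qed.

Lemma Fp_red_kernel a b (X : 'M['Z_(p ^ k)]_(a, b)) :
  map_mx Fp_red X = 0 -> exists Y, X = p%:R *: Y.
Proof.
(* Natural representatives of the entries are divisible by [p], so integer division by [p] is
   exact. *)
move=> X0; exists (\matrix_(i, j) (X i j %/ p)%:R).
apply/matrixP => i j; rewrite !mxE -natrM mulnC divnK ?natr_Zp //.
by rewrite -Fp_red_eq0; move/matrixP: X0 => /(_ i j); rewrite !mxE => ->.
Qed.

Lemma Fp_red_natp : Fp_red p%:R = 0.
Proof. by rewrite rmorph_nat (pcharf0 (pchar_Fp p_prime)). Qed.

Lemma Fp_red_unit x : (x \is a GRing.unit) = (Fp_red x != 0).
Proof.
rewrite -[x in LHS]natr_Zp unitZpE // coprime_pexpl // prime_coprime //.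
by rewrite Fp_red_eq0.
Qed.

Lemma natp_nilp : (p%:R : 'Z_(p ^ k)) ^+ k = 0.
Proof. by rewrite -natrX pchar_Zp. Qed.

Lemma unitmx_Fp_red n (X : 'M['Z_(p ^ k)]_n) :
  (X \in unitmx) = (map_mx Fp_red X \in unitmx).
Proof. by rewrite !unitmxE det_map_mx Fp_red_unit unitfE. Qed.

(** Both sides are residues of components of [x], at indices [k] and 0; coherence lowers the index
    one step at a time. *)
Lemma Fp_red_padic_mod (x : padic p) : Fp_red (padic_mod k x) = padic_residue x.
Proof.
rewrite /= zmod_redK ?Fp_trunc_dvd // /padic_residue.
elim: k => // i <-; rewrite -(padic_coherent x i) zmod_redK // pdiv_id //.
have p_exp : (1 < p ^ i.+1)%N by rewrite -(exp1n i.+1) ltn_exp2r // prime_gt1.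
by rewrite !Zp_cast // ?prime_gt1 // dvdn_exp.
Qed.

Lemma map_Fp_red_poly_mod (P : {poly padic p}) :
  map_poly Fp_red (poly_mod k P) = poly_residue P.
Proof.
apply/polyP => i; rewrite coef_map /= !coef_map_id0 ?Fp_red_padic_mod //.
exact: Fp_red_padic_mod.
Qed.

End Reduction.

Lemma monic_poly_mod p k (P : {poly padic p}) :
  P \is monic -> poly_mod k P \is monic.
Proof.
move=> /monicP P1; apply/monicP.
by rewrite lead_coef_map_id0 ?P1 ?oner_eq0.
Qed.

Lemma size_poly_mod p k (P : {poly padic p}) :
  P \is monic -> size (poly_mod k P) = size P.
Proof. by move=> /monicP P1; rewrite size_map_poly_id0 // P1 oner_eq0. Qed.

(** Over the closed field Q(J) is a nonzero scalar times a product of factors J - a with a a root of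
    Q; the kernel of such a factor is the eigenspace of a, hence zero. *)
Lemma mx_eval_unit (F : fieldType) (L : closedFieldType)
    (f : {rmorphism F -> L}) (Q : {poly F}) n (J : 'M[F]_n) : Q != 0 ->
    (forall a, eigenvalue (map_mx f J) a -> ~~ root (map_poly f Q) a) ->
  mx_eval Q J \in unitmx.
Proof.
rewrite -(map_poly_eq0 f) -(map_unitmx f) map_mx_eval.
move: (map_poly f Q) (map_mx f J) => {}Q {}J Q_neq0 noroot.
have [s QE] := closed_field_poly_normal Q.
(* Kept apart from the factorisation so that the induction on [s] can forget how [s] is tied to
   Q. *)
have rootQ a : a \in s -> root Q a.
  by move=> sa; rewrite QE rootZ ?lead_coef_eq0 // root_prod_XsubC.
rewrite QE -mul_polyC mx_evalM mx_evalC unitmx_mul; apply/andP; split.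
  by rewrite unitmxE det_scalar unitrX // unitfE lead_coef_eq0.
elim: s rootQ {QE} => [|a s IH] rootQ.
  by rewrite big_nil mx_eval1 unitmx1.
rewrite big_cons mx_evalM unitmx_mul; apply/andP; split; last first.
  by apply: IH => b sb; rewrite rootQ // inE sb orbT.
rewrite -polyCN mx_evalD mx_evalX mx_evalC rmorphN /=.
rewrite -row_free_unit -kermx_eq0 -[_ == 0]negbK; apply: contraL.
  by move=> ev; apply: (noroot a).
by rewrite rootQ ?mem_head.
Qed.

(** * Averages over matrices with a prescribed residue *)

Section FiberAverage.
Variables (R : realType) (p k : nat).
Local Notation Zpk := 'Z_(p ^ k).

(** Independence tested on singletons writes the mass of a matrix as a product of marginals. A
    marginal in the [L] by [L] submatrix depends only on the residue, and elsewhere the entries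
    coincide. *)
Lemma mass_eq_off_uniform n (A : 'M['F_p]_n) (mu : 'M[Zpk]_n -> R)
    (L : pred 'I_n) :
    independent_entries A mu ->
    (forall i j, L i -> L j -> uniform_entry A mu i j) ->
  forall X Y, X \in mx_fiber k A -> Y \in mx_fiber k A ->
    (forall i j, ~~ (L i && L j) -> X i j = Y i j) -> mu X = mu Y.
Proof.
move=> indep unif_L X Y XD YD XY.
have muE Z : Z \in mx_fiber k A ->
    mu Z = \prod_i \prod_j Pr (mx_fiber k A) mu (fun W => W i j == Z i j).
  move=> ZD; have := indep (fun i j => [set Z i j]).
  have PrE i j : Pr (mx_fiber k A) mu (fun W => W i j \in [set Z i j]) =
      Pr (mx_fiber k A) mu (fun W => W i j == Z i j).
    by apply: eq_bigl => W; rewrite inE.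
  under eq_bigr => i _ do under eq_bigr => j _ do rewrite PrE.
  move=> <-; rewrite /Pr (big_pred1 Z) // => W /=.
  apply/andP/eqP => [[_ /forallP WZ]|->].
    by apply/matrixP => i j; have /forallP/(_ j) := WZ i; rewrite inE => /eqP.
  by split=> //; apply/forallP => i; apply/forallP => j; rewrite inE.
rewrite !muE //; apply: eq_bigr => i _; apply: eq_bigr => j _.
have [/andP[Li Lj]|/XY -> //] := boolP (L i && L j).
have red W : W \in mx_fiber k A -> zmod_red (pdiv p) (W i j) = A i j.
  by rewrite inE => /eqP <-; rewrite mxE.
by rewrite !unif_L // red.
Qed.

Variables (m r : nat) (J : 'M['F_p]_m) (B : 'M['F_p]_(m, r)).
Variables (C : 'M['F_p]_(r, m)) (J' : 'M['F_p]_r).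

Definition rect_fiber a b (A : 'M['F_p]_(a, b)) : {set 'M[Zpk]_(a, b)} :=
  [set X | map_mx (zmod_red (pdiv p)) X == A].

Lemma block_mx_fiber X1 X2 X3 X4 :
  (block_mx X1 X2 X3 X4 \in mx_fiber k (block_mx J B C J')) =
  [&& X1 \in rect_fiber J, X2 \in rect_fiber B, X3 \in rect_fiber C
    & X4 \in rect_fiber J'].
Proof.
rewrite !inE map_block_mx; apply/eqP/and4P => [/eq_block_mx[-> -> -> ->] //|].
by move=> [/eqP-> /eqP-> /eqP-> /eqP->].
Qed.

Lemma sum_mx_fiber_block (G : 'M[Zpk]_(m + r) -> R) :
  \sum_(X in mx_fiber k (block_mx J B C J')) G X =
  \sum_(X1 in rect_fiber J) \sum_(X2 in rect_fiber B)
    \sum_(X3 in rect_fiber C) \sum_(X4 in rect_fiber J')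
      G (block_mx X1 X2 X3 X4).
Proof.
rewrite 3!pair_big /=.
pose b (q : 'M[Zpk]_m * 'M[Zpk]_(m, r) * 'M[Zpk]_(r, m) * 'M[Zpk]_r) :=
  block_mx q.1.1.1 q.1.1.2 q.1.2 q.2.
rewrite (reindex b) /=; last first.
  apply: onW_bij.
  exists (fun X => (ulsubmx X, ursubmx X, dlsubmx X, drsubmx X)) => [q|X].
    rewrite /b block_mxKul block_mxKur block_mxKdl block_mxKdr.
    by case: q => [[[]]].
  by rewrite /b /= submxK.
by apply: eq_bigl => q; rewrite block_mx_fiber !andbA.
Qed.

(** Given the other blocks, X4 is uniform, so its conditional average of [f] is K divided by the
    number of X4; multiplying by that number avoids the division. *)
Lemma Ex_mx_fiber_block (mu f : 'M[Zpk]_(m + r) -> R) (K : R) :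
    \sum_(X in mx_fiber k (block_mx J B C J')) mu X = 1 ->
    (forall X1 X2 X3 X4 Y4,
       block_mx X1 X2 X3 X4 \in mx_fiber k (block_mx J B C J') ->
       block_mx X1 X2 X3 Y4 \in mx_fiber k (block_mx J B C J') ->
       mu (block_mx X1 X2 X3 X4) = mu (block_mx X1 X2 X3 Y4)) ->
    (forall X1 X2 X3, X1 \in rect_fiber J -> X3 \in rect_fiber C ->
       \sum_(X4 in rect_fiber J') f (block_mx X1 X2 X3 X4) = K) ->
  Ex (mx_fiber k (block_mx J B C J')) mu f * #|rect_fiber J'|%:R = K.
Proof.
move=> mu1 mu_dr fK.
rewrite -[RHS]mul1r -[in RHS]mu1 /Ex !sum_mx_fiber_block !mulr_suml.
apply: eq_bigr => X1 X1D; rewrite !mulr_suml; apply: eq_bigr => X2 X2D.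
rewrite !mulr_suml; apply: eq_bigr => X3 X3D.
rewrite -[K](fK X1 X2 X3) // mulr_suml [RHS]mulr_suml.
(* The cardinality becomes a sum over a second copy Y4 of the block; the two double sums then agree
   term by term, [mu] being the same at X4 and Y4. *)
under eq_bigr => X4 _ do rewrite mulr_natr -sumr_const.
under [RHS]eq_bigr => X4 _ do rewrite mulr_sumr.
rewrite exchange_big /=; apply: eq_bigr => Y4 Y4D; apply: eq_bigr => X4 X4D.
by congr (_ * _); apply: mu_dr; rewrite block_mx_fiber X1D X2D X3D.
Qed.

End FiberAverage.

Theorem theorem6p1 (R : realType) (p k m r : nat) (P : {poly padic p})
    (p_prime : prime p) (k_ge2 : (2 <= k)%N) (n_ge1 : (1 <= m + r)%N)
    (P_monic : P \is monic) (P_nonconstant : (1 < size P)%N)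
    (fr : finLmodType {poly %/ poly_residue P})
    (dim_fr : Vector.axiom r
       (restrict_scalars (qpolyC (poly_residue P)) fr))
    (J : 'M['F_p]_m) (J' : 'M['F_p]_r) (B : 'M['F_p]_(m, r))
    (A : 'M['F_p]_(m + r)) (A_block : A = block_mx J B 0 J')
    (A_cok : lmod_iso
       (restrict_scalars (in_qpoly (poly_residue P))
          (cok_poly (poly_residue P) A))
       (restrict_scalars (in_qpoly (poly_residue P)) fr))
    (J_eig : forall a, eigenvalue_bar J a -> ~~ root_bar (poly_residue P) a)
    (J'_eig : forall a, eigenvalue_bar J' a -> root_bar (poly_residue P) a)
    (mu : 'M['Z_(p ^ k)]_(m + r) -> R)
    (mu_prob : is_prob (mx_fiber k A) mu)
    (mu_indep : independent_entries A mu)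
    (mu_unif : forall i j : 'I_r,
       uniform_entry A mu (rshift m i) (rshift m j))
    (H : finLmodType {poly %/ poly_mod k P}) :
  Ex (mx_fiber k A) mu
     (fun X => #|Sur (cok_sub_t (poly_mod k P) X) H|%:R)
  = sur_moment R A H.
Proof.
have k_gt0 : (0 < k)%N by apply: ltnW.
pose Pk := poly_mod k P.
(* [mk_monic] takes a default value unless its argument is monic and non-constant. *)
have PkE : mk_monic Pk = Pk.
  by rewrite /mk_monic monic_poly_mod // size_poly_mod // P_nonconstant.
pose red := Fp_red p_prime k_gt0.
have J_unit : mx_eval (poly_residue P) J \in unitmx.
  apply: mx_eval_unit J_eig; rewrite -(map_Fp_red_poly_mod p_prime k_gt0).
  exact/monic_neq0/monic_map/monic_poly_mod.
pose f (X : 'M_(m + r)) : R := #|gen_solutions X H|%:R.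
(* The common value, which depends on neither [mu] nor the blocks X1, X2, X3. *)
pose K : R := (\sum_(X4 in rect_fiber k J') #|gen_solutions X4 H|)%:R.
have fK X1 X2 X3 : X1 \in rect_fiber k J ->
    X3 \in rect_fiber k (0 : 'M_(r, m)) ->
    \sum_(X4 in rect_fiber k J') f (block_mx X1 X2 X3 X4) = K.
  rewrite !inE => /eqP X1J /eqP X30.
  (* Invertibility of P(J) lifts from the residue field, where a determinant is a unit as soon as
     its residue is nonzero. *)
  have X1_unit : mx_eval Pk X1 \in unitmx.
    rewrite (unitmx_Fp_red p_prime k_gt0) map_mx_eval map_Fp_red_poly_mod.
    by rewrite [map_mx _ _]X1J.
  have [Y3 ->] := Fp_red_kernel (p_prime := p_prime) (k_gt0 := k_gt0) X30.
  rewrite -natr_sum /K.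
  have PX1_inv : mx_eval (mk_monic Pk) X1 *m invmx (mx_eval Pk X1) = 1%:M.
    by rewrite PkE mulmxV.
  rewrite (sum_gen_solutions_block H (natp_nilp p_prime k_gt0) _ _ PX1_inv) //.
  (* Adding a multiple of [p] leaves the residue J' unchanged. *)
  move=> X Z; rewrite !inE => /eqP <-; apply/eqP.
  rewrite -[LHS]/(map_mx red _) map_mxD map_mxZ.
  by rewrite [red _](Fp_red_natp p_prime k_gt0) scale0r addr0.
have [_ mu1] := mu_prob.
rewrite A_block in mu1 mu_indep mu_unif *.
set D := mx_fiber k _ in mu1 *.
(* Total mass 1 forces the fibre to be nonempty, which makes the cardinalities below invertible. *)
have [X0 X0D] : exists X0, X0 \in D.
  apply/set0Pn; apply/eqP => D0; move: mu1; rewrite D0 big_set0 => /eqP.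
  by rewrite eq_sym oner_eq0.
have D4_neq0 : #|rect_fiber k J'|%:R != 0 :> R.
  rewrite pnatr_eq0 -lt0n; apply/card_gt0P; exists (drsubmx X0).
  by move: X0D; rewrite -[X0]submxK block_mx_fiber block_mxKdr => /and4P[].
have -> : sur_moment R (block_mx J B 0 J') H = Ex D (unif R D) f.
  by apply: eq_bigr => X _; rewrite card_Sur_cok_poly.
have -> : Ex D mu (fun X => #|Sur (cok_sub_t Pk X) H|%:R) = Ex D mu f.
  by apply: eq_bigr => X _; rewrite card_Sur_cok_sub_t.
(* The averaging lemma applies to [mu] and to the uniform measure with the same [K]; constancy in X4
   is immediate for the latter. *)
apply: (mulIf D4_neq0); rewrite !(Ex_mx_fiber_block (K := K)) //.
  rewrite sumr_const -[_ *+ _]mulr_natr mulVf // pnatr_eq0 -lt0n.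
  by apply/card_gt0P; exists X0.
move=> X1 X2 X3 X4 Y4 XD YD.
(* [L] selects the last [r] indices, so the [L] by [L] submatrix is the bottom-right block. *)
apply: (mass_eq_off_uniform (L := fun i => m <= i)%N mu_indep _ _ _ XD YD).
  move=> i j; rewrite -(splitK i) -(splitK j).
  case: (split i) => i' /=; first by rewrite leqNgt ltn_ord.
  case: (split j) => j' /= _; first by rewrite leqNgt ltn_ord.
  by move=> _; apply: mu_unif.
move=> i j; rewrite -(splitK i) -(splitK j).
case: (split i) => i' /=; case: (split j) => j' /=;
  rewrite ?block_mxEul ?block_mxEur ?block_mxEdl // ?leq_addr //.
Qed.
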